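(* Let $n$ be a positive integer. If $R$ is a prime ring, then $MC_n(R)$ is a prime ring.
   Context: All rings are associative with $1$. A ring $R$ is prime if its zero ideal is prime, i.e. for $a,b\in R$, if $axb=0$ for all $x\in R$ then $a=0$ or $b=0$ (with the usual convention that a prime ring is nonzero). $M_m(R)$ is the ring of $m\times m$ matrices over $R$. Identify $M_n(M_{n^k}(R))$ with $M_{n^{k+1}}(R)$ via block matrices. The $n$-matricial closure $MC_n(R)$ is the direct limit of the rings $M_{n^k}(R)$, $k\in\mathbb{N}=\{0,1,2,\dots\}$ (with $M_{n^0}(R)=R$), along the injective ring morphisms $M_{n^k}(R)\to M_{n^{k+1}}(R)$ sending $A$ to the block diagonal matrix with $n$ diagonal blocks equal to $A$. *)

(* Defs.v *)
From HB Require Import structures.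
From mathcomp Require Import all_boot all_order all_algebra.
From mathcomp Require Import generic_quotient.
From mathcomp Require Import boolp.

Set Implicit Arguments.
Unset Strict Implicit.
Unset Printing Implicit Defensive.

Import GRing.Theory.
Local Open Scope ring_scope.
Local Open Scope quotient_scope.

(* R is a possibly trivial, not necessarily commutative ring with 1; the first
   conjunct is the convention that a prime ring is nonzero.                   *)
Definition prime_ring (R : pzRingType) : Prop :=
  (1 : R) <> 0 /\
  forall a b : R, (forall x : R, a * x * b = 0) -> a = 0 \/ b = 0.

Section DirectLimit.
Variables (R : nat -> pzRingType) (f : forall k, {rmorphism R k -> R k.+1}).

(* The transition map R k -> R m, i.e. the composite of f k, ..., f m.-1 when
   k <= m. It is totalized by 0 when m < k, a case that is never used below.  *)
Fixpoint trans (k m : nat) (a : R k) : R m :=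
  match k =P m with
  | ReflectT e => ecast i (R i) e a
  | ReflectF _ =>
      match m return R m with
      | 0 => 0
      | m'.+1 => f m' (trans m' a)
      end
  end.

Lemma trans_id k (a : R k) : trans k a = a.
Proof.
by case: k a => [|k] a /=; case: eqP => // e; rewrite (eq_axiomK e).
Qed.

Lemma transS k m (a : R k) : (k <= m)%N -> trans m.+1 a = f m (trans m a).
Proof.
by move=> lekm /=; case: eqP => // e; exfalso; move: lekm; rewrite e ltnn.
Qed.

Lemma trans_trans k l m (a : R k) :
  (k <= l)%N -> (l <= m)%N -> trans m (trans l a) = trans m a.
Proof.
move=> lekl; elim: m => [|m IHm].
  by case: l lekl => // lekl _; rewrite trans_id.
rewrite leq_eqVlt => /predU1P[->|]; first by rewrite trans_id.
by rewrite ltnS => lelm; rewrite !transS ?IHm // (leq_trans lekl).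
Qed.

Lemma trans_ind (P : forall k m, (R k -> R m) -> Prop) :
    (forall k, P k k id) ->
    (forall k m (g : R k -> R m), P k m g -> P k m.+1 (f m \o g)) ->
  forall k m, (k <= m)%N -> P k m (@trans k m).
Proof.
move=> Pid Pf k; elim=> [|m IHm].
  by case: k => // _; have -> : @trans 0 0 = id by apply/funext/trans_id.
rewrite leq_eqVlt => /predU1P[->|].
  by have -> : @trans m.+1 m.+1 = id by apply/funext/trans_id.
rewrite ltnS => lekm.
have -> : @trans k m.+1 = f m \o @trans k m by apply/funext=> a; apply: transS.
exact/Pf/IHm.
Qed.

Lemma transB k m (a b : R k) :
  (k <= m)%N -> trans m (a - b) = trans m a - trans m b.
Proof.
move=> lekm; move: a b; move: k m lekm.
apply: (trans_ind (P := fun k m g => {morph g : a b / a - b})) => //.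
move=> k m g IH a b /=.
by rewrite IH rmorphB.
Qed.

Lemma trans0 k m : (k <= m)%N -> trans m (0 : R k) = 0.
Proof. by move=> le; rewrite -(subrr 0) transB // subrr. Qed.

Lemma transN k m (a : R k) : (k <= m)%N -> trans m (- a) = - trans m a.
Proof. by move=> le; rewrite -sub0r transB // trans0 // sub0r. Qed.

Lemma transD k m (a b : R k) :
  (k <= m)%N -> trans m (a + b) = trans m a + trans m b.
Proof. by move=> le; rewrite -{1}[b]opprK transB // transN // opprK. Qed.

Lemma transM k m (a b : R k) :
  (k <= m)%N -> trans m (a * b) = trans m a * trans m b.
Proof.
move=> lekm; move: a b; move: k m lekm.
apply: (trans_ind (P := fun k m g => {morph g : a b / a * b})) => //.
move=> k m g IH a b /=.
by rewrite IH rmorphM.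
Qed.

Lemma trans1 k m : (k <= m)%N -> trans m (1 : R k) = 1.
Proof.
move: k m; apply: (trans_ind (P := fun k m g => g 1 = 1)) => // k m g IH /=.
by rewrite IH rmorph1.
Qed.

(* Two elements of the disjoint union of the R k are identified when they
   become equal at some later stage.                                          *)
Definition dl_rel (x y : {k & R k}) : bool :=
  `[< exists m, [/\ (tag x <= m)%N, (tag y <= m)%N
                  & trans m (tagged x) = trans m (tagged y)] >].

Lemma dl_rel_refl : reflexive dl_rel.
Proof. by move=> x; apply/asboolP; exists (tag x). Qed.

Lemma dl_rel_sym : symmetric dl_rel.
Proof.
by move=> x y; apply/asboolP/asboolP => -[m [? ? ?]]; exists m.
Qed.

Lemma dl_rel_trans : transitive dl_rel.
Proof.
move=> y x z /asboolP[m [xm ym xy]] /asboolP[p [yp zp yz]].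
apply/asboolP; exists (maxn m p).
have mle := leq_maxl m p; have ple := leq_maxr m p.
split; [exact: leq_trans mle | exact: leq_trans ple |].
rewrite -(trans_trans _ xm mle) xy trans_trans //.
by rewrite -(trans_trans _ yp ple) yz trans_trans.
Qed.

Canonical dl_equiv := EquivRel dl_rel dl_rel_refl dl_rel_sym dl_rel_trans.

Definition dirlim := {eq_quot dl_equiv}.
HB.instance Definition _ := Choice.on dirlim.
HB.instance Definition _ := EqQuotient.on dirlim.

Definition dl_in k (a : R k) : dirlim := \pi_dirlim (Tagged R a).

Lemma dl_in_eq k l (a : R k) (b : R l) :
  dl_in a = dl_in b <->
  exists m, [/\ (k <= m)%N, (l <= m)%N & trans m a = trans m b].
Proof. by split=> [/eqmodP/asboolP|H]; last exact/eqmodP/asboolP. Qed.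

Lemma dl_in_trans k m (a : R k) : (k <= m)%N -> dl_in (trans m a) = dl_in a.
Proof. by move=> lekm; apply/dl_in_eq; exists m; rewrite trans_id. Qed.

Lemma dl_in_f k (a : R k) : dl_in (f k a) = dl_in a.
Proof. by rewrite -(dl_in_trans a (leqnSn k)) transS // trans_id. Qed.

Lemma dl_in_surj (x : dirlim) : exists k (a : R k), x = dl_in a.
Proof.
exists (tag (repr x)), (tagged (repr x)).
by rewrite /dl_in taggedK reprK.
Qed.

(* Sums and products are computed on representatives moved to a common
   stage; dl_op_in below shows independence of the representatives.           *)
Definition dl_op (op : forall m, R m -> R m -> R m) (x y : dirlim) : dirlim :=
  let m := maxn (tag (repr x)) (tag (repr y)) in
  dl_in (op m (trans m (tagged (repr x))) (trans m (tagged (repr y)))).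

Definition dl_zero : dirlim := dl_in (0 : R 0).
Definition dl_one : dirlim := dl_in (1 : R 0).
Definition dl_opp (x : dirlim) : dirlim := dl_in (- tagged (repr x)).
Definition dl_add : dirlim -> dirlim -> dirlim := dl_op (fun m => +%R).
Definition dl_mul : dirlim -> dirlim -> dirlim := dl_op (fun m => *%R).

Lemma dl_repr k (a : R k) : exists m, [/\ (k <= m)%N,
  (tag (repr (dl_in a)) <= m)%N & trans m (tagged (repr (dl_in a))) = trans m a].
Proof.
have : dl_in (tagged (repr (dl_in a))) = dl_in a.
  by rewrite {1}/dl_in taggedK reprK.
by case/dl_in_eq=> m [? ? ?]; exists m.
Qed.

Lemma dl_op_in (op : forall m, R m -> R m -> R m) :
    (forall k m (a b : R k), (k <= m)%N ->
       trans m (op k a b) = op m (trans m a) (trans m b)) ->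
  forall k (a b : R k), dl_op op (dl_in a) (dl_in b) = dl_in (op k a b).
Proof.
move=> opT k a b; have [m [km am am_eq]] := dl_repr a.
have [p [kp bp bp_eq]] := dl_repr b.
have mle := leq_maxl m p; have ple := leq_maxr m p.
apply/dl_in_eq; exists (maxn m p); set q := maxn m p.
have aq : (tag (repr (dl_in a)) <= q)%N := leq_trans am mle.
have bq : (tag (repr (dl_in b)) <= q)%N := leq_trans bp ple.
have kq : (k <= q)%N := leq_trans km mle.
have abq : (maxn (tag (repr (dl_in a))) (tag (repr (dl_in b))) <= q)%N.
  by rewrite geq_max aq.
split=> //; rewrite !opT // !trans_trans ?leq_maxl ?leq_maxr //.
congr (op _ _ _).
  by rewrite -(trans_trans _ am mle) am_eq trans_trans.
by rewrite -(trans_trans _ bp ple) bp_eq trans_trans.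
Qed.

Lemma dl_addE k (a b : R k) : dl_add (dl_in a) (dl_in b) = dl_in (a + b).
Proof. by apply: (dl_op_in (op := fun m => +%R)) => *; apply: transD. Qed.

Lemma dl_mulE k (a b : R k) : dl_mul (dl_in a) (dl_in b) = dl_in (a * b).
Proof. by apply: (dl_op_in (op := fun m => *%R)) => *; apply: transM. Qed.

Lemma dl_zeroE k : dl_zero = dl_in (0 : R k).
Proof. by apply/dl_in_eq; exists k; rewrite !trans0. Qed.

Lemma dl_oneE k : dl_one = dl_in (1 : R k).
Proof. by apply/dl_in_eq; exists k; rewrite !trans1. Qed.

Lemma dl_oppE k (a : R k) : dl_opp (dl_in a) = dl_in (- a).
Proof.
have [m [km am am_eq]] := dl_repr a.
by apply/dl_in_eq; exists m; rewrite !transN // am_eq.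
Qed.

Lemma dl_in_common2 (x y : dirlim) :
  exists k (a b : R k), x = dl_in a /\ y = dl_in b.
Proof.
have [k [a ->]] := dl_in_surj x; have [l [b ->]] := dl_in_surj y.
exists (maxn k l), (trans _ a), (trans _ b).
by rewrite !dl_in_trans ?leq_maxl ?leq_maxr.
Qed.

Lemma dl_in_common3 (x y z : dirlim) :
  exists k (a b c : R k), [/\ x = dl_in a, y = dl_in b & z = dl_in c].
Proof.
have [k [a [b [-> ->]]]] := dl_in_common2 x y.
have [l [c ->]] := dl_in_surj z.
exists (maxn k l), (trans _ a), (trans _ b), (trans _ c).
by rewrite !dl_in_trans ?leq_maxl ?leq_maxr.
Qed.

Lemma dl_addA : associative dl_add.
Proof.
move=> x y z; have [k [a [b [c [-> -> ->]]]]] := dl_in_common3 x y z.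
by rewrite !dl_addE addrA.
Qed.

Lemma dl_addC : commutative dl_add.
Proof.
move=> x y; have [k [a [b [-> ->]]]] := dl_in_common2 x y.
by rewrite !dl_addE addrC.
Qed.

Lemma dl_add0 : left_id dl_zero dl_add.
Proof.
by move=> x; have [k [a ->]] := dl_in_surj x; rewrite (dl_zeroE k) dl_addE add0r.
Qed.

Lemma dl_addN : left_inverse dl_zero dl_opp dl_add.
Proof.
move=> x; have [k [a ->]] := dl_in_surj x.
by rewrite dl_oppE dl_addE addNr -dl_zeroE.
Qed.

HB.instance Definition _ :=
  GRing.isZmodule.Build dirlim dl_addA dl_addC dl_add0 dl_addN.

Lemma dl_mulA : associative dl_mul.
Proof.
move=> x y z; have [k [a [b [c [-> -> ->]]]]] := dl_in_common3 x y z.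
by rewrite !dl_mulE mulrA.
Qed.

Lemma dl_mul1 : left_id dl_one dl_mul.
Proof.
by move=> x; have [k [a ->]] := dl_in_surj x; rewrite (dl_oneE k) dl_mulE mul1r.
Qed.

Lemma dl_mulr1 : right_id dl_one dl_mul.
Proof.
by move=> x; have [k [a ->]] := dl_in_surj x; rewrite (dl_oneE k) dl_mulE mulr1.
Qed.

Lemma dl_mulDl : left_distributive dl_mul dl_add.
Proof.
move=> x y z; have [k [a [b [c [-> -> ->]]]]] := dl_in_common3 x y z.
by rewrite !(dl_addE, dl_mulE) mulrDl.
Qed.

Lemma dl_mulDr : right_distributive dl_mul dl_add.
Proof.
move=> x y z; have [k [a [b [c [-> -> ->]]]]] := dl_in_common3 x y z.
by rewrite !(dl_addE, dl_mulE) mulrDr.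
Qed.

HB.instance Definition _ :=
  GRing.Zmodule_isPzRing.Build dirlim
    dl_mulA dl_mul1 dl_mulr1 dl_mulDl dl_mulDr.

Lemma dl_in_is_zmod_morphism k : zmod_morphism (@dl_in k).
Proof. by move=> a b; rewrite -dl_addE -dl_oppE. Qed.

Lemma dl_in_is_monoid_morphism k : monoid_morphism (@dl_in k).
Proof. by split=> [|a b]; [rewrite -dl_oneE | rewrite -dl_mulE]. Qed.

HB.instance Definition _ k :=
  GRing.isZmodMorphism.Build (R k) dirlim (@dl_in k) (@dl_in_is_zmod_morphism k).
HB.instance Definition _ k :=
  GRing.isMonoidMorphism.Build (R k) dirlim (@dl_in k)
    (@dl_in_is_monoid_morphism k).

Lemma dirlim_universal (S : pzRingType) (g : forall k, {rmorphism R k -> S}) :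
    (forall k (a : R k), g k.+1 (f k a) = g k a) ->
  exists h : {rmorphism dirlim -> S},
    (forall k (a : R k), h (dl_in a) = g k a) /\
    (forall h' : {rmorphism dirlim -> S},
       (forall k (a : R k), h' (dl_in a) = g k a) -> h' =1 h).
Proof.
move=> gf.
have gT k m (a : R k) : (k <= m)%N -> g m (trans m a) = g k a.
  move=> lekm; move: a; move: k m lekm.
  apply: (trans_ind (P := fun k m t => forall a, g m (t a) = g k a)) => //.
  by move=> k m t IH a /=; rewrite gf IH.
pose h (x : dirlim) : S := g _ (tagged (repr x)).
have hE k (a : R k) : h (dl_in a) = g k a.
  by have [m [km am e]] := dl_repr a; rewrite /h -(gT _ _ _ am) e gT.
have hB : zmod_morphism h.
  move=> x y; have [k [a [b [-> ->]]]] := dl_in_common2 x y.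
  by rewrite -rmorphB !hE rmorphB.
have hM : monoid_morphism h.
  split=> [|x y]; first by rewrite -(rmorph1 (@dl_in 0)) hE rmorph1.
  have [k [a [b [-> ->]]]] := dl_in_common2 x y.
  by rewrite -rmorphM !hE rmorphM.
pose hzm := GRing.isZmodMorphism.Build dirlim S h hB.
pose hmm := GRing.isMonoidMorphism.Build dirlim S h hM.
pose hr : {rmorphism dirlim -> S} := HB.pack h hzm hmm.
exists hr; split=> // h' h'E x.
by have [k [a ->]] := dl_in_surj x; rewrite h'E [RHS]hE.
Qed.

End DirectLimit.

Section MatricialClosure.
Variables (n : nat) (R : pzRingType).

Lemma sum_blocks k : (\sum_(i < n) n ^ k = n ^ k.+1)%N.
Proof. by rewrite sum_nat_const card_ord expnS. Qed.

(* The cast is the identification of M_n(M_(n^k)(R)) with M_(n^(k+1))(R). *)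
Definition block_diag k (A : 'M[R]_(n ^ k)) : 'M[R]_(n ^ k.+1) :=
  castmx (sum_blocks k, sum_blocks k) (\mxdiag_(i < n) A).

Lemma block_diag_is_zmod_morphism k : zmod_morphism (@block_diag k).
Proof.
move=> A B; rewrite /block_diag mxdiagB.
by case: _ / (sum_blocks k).
Qed.

Lemma block_diag_is_monoid_morphism k : monoid_morphism (@block_diag k).
Proof.
split=> [|A B]; rewrite /block_diag.
  rewrite [X in castmx _ X](mxdiagZ (p_ := fun _ : 'I_n => (n ^ k)%N) 1).
  by case: _ / (sum_blocks k).
have -> : \mxdiag_(i < n) (A * B) = \mxdiag_(i < n) A *m \mxdiag_(i < n) B.
  rewrite [X in _ *m X]/mxdiag mul_mxdiag_mxblock; apply/eq_mxblock => i j.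
  by case: (i == j); rewrite ?conform_mx_id ?mulmx0.
by case: _ / (sum_blocks k).
Qed.

HB.instance Definition _ k :=
  GRing.isZmodMorphism.Build 'M[R]_(n ^ k) 'M[R]_(n ^ k.+1) (@block_diag k)
    (@block_diag_is_zmod_morphism k).
HB.instance Definition _ k :=
  GRing.isMonoidMorphism.Build 'M[R]_(n ^ k) 'M[R]_(n ^ k.+1) (@block_diag k)
    (@block_diag_is_monoid_morphism k).

Lemma block_diag_inj k : (0 < n)%N -> injective (@block_diag k).
Proof.
move=> n0 A B /(can_inj (castmxK _ _))/eq_mxdiagP; apply.
exact: Ordinal n0.
Qed.

(* Level k = 0 is 'M[R]_1 (n ^ 0 reduces to 1), identified with R. *)
Definition MC : pzRingType :=
  dirlim (R := fun k => 'M[R]_(n ^ k)) (fun k => @block_diag k).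

End MatricialClosure.

(* Main.v *)
(** If [A i j] and [B k l] are both nonzero, primeness of [R] gives [x] with
    [A i j * x * B k l <> 0]; this is the entry [(i, l)] of
    [A *m (x *: delta_mx j k) *m B], so matrix rings over [R] are prime. The
    transition maps being injective, the stages embed in the limit, and
    primeness is tested on two elements of a common stage. *)
Require Import Defs.
From mathcomp Require Import all_boot all_order all_algebra.

Import GRing.Theory.
Local Open Scope ring_scope.

(** Right multiplication by [x *: delta_mx j k] puts column [j] of [A], times [x], in column [k] and
    zeros elsewhere. *)
Lemma mulmx_delta_mulE (R : pzRingType) (m n p q : nat) (A : 'M[R]_(m, n))
    (B : 'M[R]_(p, q)) (x : R) i j k l :
  (A *m (x *: delta_mx j k) *m B) i l = A i j * x * B k l.
Proof.
have AE k' : (A *m (x *: delta_mx j k)) i k' = A i j * x *+ (k' == k).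
  rewrite mxE (bigD1 j) //= big1 => [|j' /negPf nj'].
    by rewrite addr0 !mxE eqxx /= mulr_natr mulrnAr.
  by rewrite !mxE nj' !mulr0.
rewrite mxE (bigD1 k) //= big1 => [|k' /negPf nk']; rewrite AE.
  by rewrite eqxx addr0.
by rewrite nk' mul0r.
Qed.

Lemma prime_ring_matrix (R : pzRingType) (m : nat) :
  (0 < m)%N -> prime_ring R -> prime_ring 'M[R]_m.
Proof.
move=> m0 [R1 Rprime].
split=> [/matrixP/(_ (Ordinal m0) (Ordinal m0))|A B AB0]; first by rewrite !mxE eqxx.
have [->|/matrix0Pn[i [j Aij]]] := eqVneq A 0; [by left | right].
apply/matrixP => k l; rewrite mxE.
(* The one nonzero entry [A i j] is tested against every entry of [B]. *)
have [x|Aij0|//] := Rprime (A i j) (B k l); last by rewrite Aij0 eqxx in Aij.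
have /matrixP/(_ i l) := AB0 (x *: delta_mx j k).
by rewrite [RHS]mxE => <-; rewrite -mulmx_delta_mulE.
Qed.

Lemma trans_inj (R : nat -> pzRingType)
    (f : forall k, {rmorphism R k -> R k.+1}) :
  (forall k, injective (f k)) ->
  forall k m, (k <= m)%N -> injective (@trans R f k m).
Proof.
move=> f_inj.
apply: (trans_ind (P := fun k m g => injective g)) => [k a b|k m g g_inj a b].
  by [].
by move=> /f_inj/g_inj.
Qed.

(** Elements equal in the limit already agree at a later stage, and [trans] is injective. *)
Lemma dl_in_inj (R : nat -> pzRingType)
    (f : forall k, {rmorphism R k -> R k.+1}) :
  (forall k, injective (f k)) -> forall k, injective (@dl_in R f k).
Proof.
by move=> f_inj k a b /dl_in_eq[m [km _ /(trans_inj _ _ f_inj _ _ km)]].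
Qed.

Lemma prime_ring_dirlim (R : nat -> pzRingType)
    (f : forall k, {rmorphism R k -> R k.+1}) :
  (forall k, injective (f k)) -> (forall k, prime_ring (R k)) ->
  prime_ring (dirlim f).
Proof.
move=> /dl_in_inj in_inj Rprime; split=> [|x y].
  rewrite -(rmorph1 (@dl_in R f 0)) -(rmorph0 (@dl_in R f 0)) => /in_inj.
  by case: (Rprime 0%N).
have [k [a [b [-> ->]]]] := dl_in_common2 x y => ab0.
have [z|->|->] := (Rprime k).2 a b; last 2 first.
- by left; rewrite rmorph0.
- by right; rewrite rmorph0.
(* Only middle factors [dl_in z] from stage [k] itself are needed. *)
by apply: in_inj; rewrite !rmorphM rmorph0 ab0.
Qed.

Theorem proposition30 (n : nat) (hn : (0 < n)%N) (R : pzRingType)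
  (hR : prime_ring R) : prime_ring (MC n R).
Proof.
(* [0 < n] provides a block to recover [A] from, and below it makes [n ^ k] positive. *)
apply: prime_ring_dirlim => k; first exact: block_diag_inj.
by apply: prime_ring_matrix; rewrite ?expn_gt0 ?hn.
Qed.
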